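(* Let $n$ be a positive integer and $\mathbf b=(b_1,\dots,b_n)\in\mathbb Z_{>0}^n$, not with $n=1=b_1$. Let $f_k$ be the number of $k$-dimensional faces of $\mathfrak X_n(\mathbf b)$ for $k=0,1,\dots,n$. Then $$f_k=\begin{cases}\displaystyle\sum_{j=0,\ j\ne1}^{n-k}\binom nj\,(n-k-j)!\;S(n-j+1,\,n-k-j+1)&\text{if }b_1=1,\\[2mm]\displaystyle\sum_{j=0}^{n-k}\binom nj\,(n-k-j)!\;S(n-j+1,\,n-k-j+1)&\text{if }b_1\ge2,\end{cases}$$ where $S(m,r)$ denotes the Stirling number of the second kind.
   Context: A $\mathbf b$-parking function is a list $(\beta_1,\dots,\beta_n)$ of positive integers whose nondecreasing rearrangement $\beta'_1\le\cdots\le\beta'_n$ satisfies $\beta'_i\le b_1+\cdots+b_i$ for all $i$. The $\mathbf b$-parking-function polytope $\mathfrak X_n(\mathbf b)\subset\mathbb R^n$ is the convex hull of all $\mathbf b$-parking functions. The polytope itself is counted as its unique $n$-dimensional face. $S(m,r)$ is the number of partitions of an $m$-element set into $r$ nonempty blocks. *)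

(* Defs.v *)
From mathcomp Require Import all_boot all_order all_algebra.
From mathcomp Require Import boolp classical_sets functions cardinality reals convex.

Set Implicit Arguments.
Unset Strict Implicit.
Unset Printing Implicit Defensive.

Import Order.TTheory GRing.Theory Num.Theory.

Local Open Scope classical_set_scope.
Local Open Scope ring_scope.

Definition stirling2 (m r : nat) : nat :=
  #|[pred P : {set {set 'I_m}} | finset.partition P [set: 'I_m]%SET && (#|P| == r)]|.

(* Positions are 0-based: the entry of index i of the sorted list is bounded by
   the sum of the entries of index 0, ..., i of b. *)
Definition parking_function (n : nat) (b beta : n.-tuple nat) : Prop :=
  (forall i : 'I_n, 0 < tnth beta i)%N /\
  (forall i : 'I_n,
     nth 0 (sort leq beta) i <= \sum_(j < n | j <= i) tnth b j)%N.

Definition convex_hull (R : realType) (n : nat) (A : set 'rV[R]_n) :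
    set 'rV[R]_n :=
  smallest (@convex_set R 'rV[R]_n) A.

Definition parking_polytope (R : realType) (n : nat) (b : n.-tuple nat) :
    set 'rV[R]_n :=
  convex_hull [set \row_i (tnth beta i)%:R | beta in parking_function b].

Arguments parking_polytope R {n} b _.

(* The pair (0, 0) makes P a face of itself; the empty set is also a face, but
   it has no dimension in the sense of has_dim below, so is never counted. *)
Definition is_face (R : realType) (n : nat) (P F : set 'rV[R]_n) : Prop :=
  exists (a : 'rV[R]_n) (c : R),
    (forall x, P x -> \sum_i a 0 i * x 0 i <= c) /\
    F = P `&` [set x : 'rV[R]_n | \sum_i a 0 i * x 0 i = c].

Definition affine_hull (R : realType) (n : nat) (A : set 'rV[R]_n) :
    set 'rV[R]_n :=
  [set y | exists (m : nat) (x : 'I_m -> 'rV[R]_n) (w : 'I_m -> R),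
     [/\ forall i, A (x i), \sum_i w i = 1 & y = \sum_i w i *: x i]].

Definition has_dim (R : realType) (n : nat) (A : set 'rV[R]_n) (k : nat) :
    Prop :=
  exists (x0 : 'rV[R]_n) (V : {vspace 'rV[R]_n}),
    \dim V = k /\ affine_hull A = [set x0 + v | v in [set v | v \in V]].

Definition faces_of_dim (R : realType) (n : nat) (P : set 'rV[R]_n) (k : nat) :
    set (set 'rV[R]_n) :=
  [set F | is_face P F /\ has_dim F k].

(* Main.v *)
(** A linear functional is a positive combination of the indicators of the
    members of a chain [C] of nonempty sets and of the [- e_i], for [i] in a set
    [N] disjoint from these members.  On the polytope, [x_i >= 1] and the sum of
    [x] over [U] is at most the sum of the [#|U|] largest [b_1 + ... + b_p].
    All the bounds given by a flag [(N, C)] are tight at a common vertex, so the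
    nonempty faces are exactly the sets [F (N, C)] of points where they are all
    tight; the dimension of [F (N, C)] is [n - #|N| - #|C|].

    If [b_1 >= 2], distinct flags give distinct faces.  If [b_1 = 1], tightness
    for the complement of [i] and [N = set0] forces [x_i = 1], so the flags
    [(set0, C)] with [[set~ i] \in C] have to be discarded: their faces come
    from flags with [N = [set i]], and there are as many of them, for a given
    [#|N| + #|C|], as flags with [#|N| = 1].

    Chains of [r] nonempty subsets of an [m]-set correspond to the functions
    to [{0, ..., r}] whose image contains [{1, ..., r}]; sending an additional
    point to 0 makes these the pointed surjections from a set of [m + 1]
    elements, of which there are [r! S(m + 1, r + 1)]. *)
Require Import Defs.
From mathcomp Require Import all_boot all_order all_algebra all_fingroup.
From mathcomp Require Import zify lra.
From mathcomp Require Import reals interval_inference.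

Set Implicit Arguments.
Unset Strict Implicit.
Unset Printing Implicit Defensive.

(** * Surjections and set partitions *)

Section Surjections.

Definition surjb (A B : finType) (f : {ffun A -> B}) : bool :=
  [forall y, exists x, f x == y].

Lemma surjbP (A B : finType) (f : {ffun A -> B}) :
  reflect (forall y, exists x, f x = y) (surjb f).
Proof.
apply: (iffP forallP) => fS y; first by have /existsP[x /eqP] := fS y; exists x.
by have [x <-] := fS y; apply/existsP; exists x.
Qed.

Lemma eq_preim_partition (A B : finType) (f g : A -> B) :
  preim_partition f [set: A] = preim_partition g [set: A] <->
  forall x y, (f x == f y) = (g x == g y).
Proof.
have eqR (h : A -> B) : {in [set: A] & &, equivalence_rel (fun x y => h x == h y)}.
  by move=> x y z _ _ _; split=> // /eqP->.
split=> [efg x y|efg].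
  have /= := pblock_equivalence_partition (eqR f) (in_setT x) (in_setT y).
  have /= := pblock_equivalence_partition (eqR g) (in_setT x) (in_setT y).
  by move=> <- <-; rewrite -/(preim_partition _ _) efg.
rewrite /preim_partition /equivalence_partition.
by apply: eq_imset => x; apply/setP=> y; rewrite !inE efg.
Qed.

(* Two surjections with the same fibers differ by a permutation of the values. *)
Lemma card_surj_partition (A : finType) (r : nat) (P : {set {set A}}) :
    partition P [set: A] -> #|P| = r ->
  #|[set f : {ffun A -> 'I_r} | surjb f && (preim_partition f [set: A] == P)]| = r`!.
Proof.
move=> partP <-.
have memP x : pblock P x \in P by apply: pblock_mem; rewrite (cover_partition partP) inE.
pose f0 := [ffun x => enum_rank_in (memP x) (pblock P x)].
have f0E x : enum_val (f0 x) = pblock P x by rewrite ffunE enum_rankK_in.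
have f0S y : exists x, f0 x == y.
  have Py := enum_valP y; have [_ tP P0] := and3P partP.
  have [x xy] : exists x, x \in enum_val y.
    by apply/set0Pn; apply: contraNneq P0 => <-.
  by exists x; apply/eqP/enum_val_inj; rewrite f0E (def_pblock tP Py xy).
have f0P : preim_partition f0 [set: A] = P.
  rewrite -[RHS](equivalence_partition_pblock partP).
  rewrite /preim_partition /equivalence_partition; apply: eq_imset => x.
  apply/setP=> y; rewrite !inE /=; have [_ tP _] := and3P partP.
  by rewrite -(inj_eq enum_val_inj) !f0E eq_pblock ?(cover_partition partP) ?inE.
rewrite -[in RHS](card_ord #|P|) -cardsT -(card_perm [set: 'I_#|P|]).
pose h (s : {perm 'I_#|P|}) := [ffun x => s (f0 x)].
have h_inj : injective h.
  move=> s t /ffunP est; apply/permP=> y; have [x /eqP <-] := f0S y.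
  by have := est x; rewrite !ffunE.
rewrite -(card_imset _ h_inj); apply: eq_card => f; rewrite !inE.
apply/andP/imsetP=> [[/surjbP fS /eqP efP]|[s _ ->]].
  have /eq_preim_partition ef := etrans efP (esym f0P).
  pose x_ y := xchoose (f0S y); have x_K y : f0 (x_ y) = y by apply/eqP/(xchooseP (f0S y)).
  have s_inj : injective (fun y => f (x_ y)).
    by move=> y z /eqP; rewrite ef !x_K => /eqP.
  exists (perm s_inj); first by apply/subsetP=> x; rewrite !inE.
  by apply/ffunP=> x; rewrite ffunE permE; apply/eqP; rewrite ef x_K.
split; last first.
  apply/eqP/(etrans _ f0P)/eq_preim_partition => x y.
  by rewrite !ffunE (inj_eq perm_inj).
apply/surjbP => y; have [x /eqP xE] := f0S ((s^-1)%g y).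
by exists x; rewrite ffunE xE permKV.
Qed.

(** Group the surjections by their partition into fibers: every partition into [r] blocks arises
    from [r!] of them. *)
Lemma card_surj_ord (m r : nat) :
  #|[set f : {ffun 'I_m -> 'I_r} | surjb f]| = r`! * stirling2 m r.
Proof.
pose Q := [set P : {set {set 'I_m}} | partition P [set: 'I_m] && (#|P| == r)].
rewrite -sum1_card.
rewrite (partition_big (fun f : {ffun 'I_m -> 'I_r} => preim_partition f [set: 'I_m])
  (mem Q)) /=; last first.
  move=> f; rewrite !inE => /surjbP fS; rewrite preim_partitionP /=.
  pose g y := [set x | f x == y].
  have g_inj : injective g.
    move=> y z egz; have [x xy] := fS y.
    have : x \in g z by rewrite -egz inE xy.
    by rewrite inE xy => /eqP.
  rewrite -[r in _ == r]card_ord -cardsT -(card_imset _ g_inj).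
  apply/eqP/eq_card => U; apply/imsetP/imsetP=> [[x _ ->]|[y _ ->]].
    by exists (f x); rewrite ?inE //; apply/setP=> z; rewrite !inE eq_sym.
  have [x xy] := fS y; exists x; rewrite ?inE //.
  by apply/setP=> z; rewrite !inE xy eq_sym.
rewrite (eq_bigr (fun=> r`!)) => [|P]; last first.
  rewrite inE => /andP[partP /eqP cP]; rewrite -(card_surj_partition partP cP) -sum1_card.
  by apply: eq_bigl => f; rewrite !inE.
rewrite sum_nat_const mulnC; congr (_ * _).
by apply: eq_card => P; rewrite !inE.
Qed.

Lemma card_surj (A : finType) (r : nat) :
  #|[set f : {ffun A -> 'I_r} | surjb f]| = r`! * stirling2 #|A| r.
Proof.
rewrite -card_surj_ord.
pose h (f : {ffun 'I_#|A| -> 'I_r}) : {ffun A -> 'I_r} := [ffun x => f (enum_rank x)].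
have h_inj : injective h.
  move=> f g /ffunP efg; apply/ffunP=> i.
  by have := efg (enum_val i); rewrite !ffunE enum_valK.
rewrite -(card_imset _ h_inj); apply: eq_card => f; rewrite !inE.
apply/surjbP/imsetP=> [fS|[g + -> y]].
  exists [ffun i => f (enum_val i)]; last by apply/ffunP=> x; rewrite !ffunE enum_rankK.
  rewrite inE; apply/surjbP=> y; have [x <-] := fS y.
  by exists (enum_rank x); rewrite ffunE enum_rankK.
rewrite inE => /surjbP /(_ y)[i <-]; exists (enum_val i).
by rewrite ffunE enum_valK.
Qed.

(** By composition with the transposition of [ord0] and [t], all [r + 1] values at [a] are equally
    frequent, so this is the number of all surjections divided by [r + 1]. *)
Lemma card_surj_pointed (A : finType) (a : A) (r : nat) :
  #|[set f : {ffun A -> 'I_r.+1} | surjb f && (f a == ord0)]|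
  = r`! * stirling2 #|A| r.+1.
Proof.
apply/eqP; rewrite -(eqn_pmul2l (ltn0Sn r)) mulnA -factS -card_surj; apply/eqP.
rewrite -[in RHS]sum1_card (partition_big (fun f : {ffun A -> 'I_r.+1} => f a) predT) //=.
rewrite (eq_bigr (fun=> #|[set f : {ffun A -> 'I_r.+1} | surjb f && (f a == ord0)]|)).
  by rewrite sum_nat_const card_ord.
move=> t _; pose h (f : {ffun A -> 'I_r.+1}) : {ffun A -> 'I_r.+1} :=
  [ffun x => tperm ord0 t (f x)].
have hK : involutive h by move=> f; apply/ffunP=> x; rewrite !ffunE tpermK.
have hS f : surjb f -> surjb (h f).
  move=> /surjbP fS; apply/surjbP => y; have [x xE] := fS (tperm ord0 t y).
  by exists x; rewrite ffunE xE tpermK.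
rewrite sum1_card -[RHS](card_imset _ (inv_inj hK)); apply: eq_card => f; rewrite [LHS]unfold_in /= inE.
apply/andP/imsetP=> [[fS /eqP fa]|[g + ->]].
  by exists (h f); rewrite ?hK // inE hS //= ffunE fa tpermR.
by rewrite inE => /andP[gS /eqP ga]; rewrite hS // ffunE ga tpermL.
Qed.

End Surjections.

(** * Flags of subsets *)

Section Flags.
Variable T : finType.
Implicit Types (N U V : {set T}) (C : {set {set T}}) (i j : T).

Definition flag N C : bool :=
  [forall U in C, [&& U != set0, [disjoint U & N] &
    [forall V in C, (U \subset V) || (V \subset U)]]].

Lemma flagP N C :
  reflect [/\ forall U, U \in C -> U != set0,
              forall U i, U \in C -> i \in U -> i \notin N
            & forall U V, U \in C -> V \in C -> (U \subset V) || (V \subset U)]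
          (flag N C).
Proof.
apply: (iffP forall_inP) => [fl|[C0 CN Cc] U CU].
  split=> [U|U i|U V] CU; first by have /and3P[] := fl U CU.
    by have /and3P[_ UN _] := fl U CU => Ui; rewrite (disjointFr UN).
  by have /and3P[_ _ /forall_inP] := fl U CU; apply.
rewrite C0 //=; apply/andP; split; last by apply/forall_inP => V; apply: Cc.
by rewrite disjoint_subset; apply/subsetP => i; rewrite inE; apply: CN.
Qed.

(* On a flag, [level] is 0 on [N], 1 outside [N] and the members of [C], and
   its superlevel sets at 2, 3, ... are the members of [C]. *)
Definition depth C i : nat := #|[set U in C | i \in U]|.
Definition level N C i : nat := depth C i + (i \notin N).
Definition upper N C i : {set T} := [set k | level N C i <= level N C k].

Section Level.
Variables (N : {set T}) (C : {set {set T}}) (flagNC : flag N C).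
Local Notation lev := (level N C).

Lemma depth_gt0 i : reflect (exists2 U, U \in C & i \in U) (0 < depth C i).
Proof.
rewrite /depth card_gt0; apply: (iffP (set0Pn _)) => [[U]|[U CU Ui]].
  by rewrite inE => /andP[]; exists U.
by exists U; rewrite inE CU.
Qed.

(** A member of the chain that contains [j] is not inside [U], so it contains [U] and hence [i]; and
    [U] itself contains only [i]. *)
Lemma level_lt U i j : U \in C -> i \in U -> j \notin U -> lev j < lev i.
Proof.
have [_ CN Cc] := flagP _ _ flagNC => CU Ui Uj.
rewrite /level (CN _ _ CU Ui) addn1 ltnS.
have: [set V in C | j \in V] \proper [set V in C | i \in V].
  apply/properP; split; last by exists U; rewrite !inE ?CU // negb_and Uj orbT.
  apply/subsetP => V; rewrite !inE => /andP[CV Vj]; rewrite CV /=.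
  have /orP[/subsetP/(_ i Ui) //|/subsetP/(_ j Vj)] := Cc U V CU CV.
  by rewrite (negbTE Uj).
move/proper_card; rewrite -/(depth C i) -/(depth C j) => lt_ji.
by apply: leq_trans lt_ji; rewrite -addn1 leq_add2l leq_b1.
Qed.

Lemma level_eq0 i : (lev i == 0) = (i \in N).
Proof.
have [_ CN _] := flagP _ _ flagNC.
rewrite /level addn_eq0 eqb0 negbK andb_idl // => Ni.
by rewrite -leqn0 leqNgt; apply/negP => /depth_gt0[U CU /(CN _ _ CU)]; rewrite Ni.
Qed.

Lemma level_ge2 i : reflect (exists2 U, U \in C & i \in U) (1 < lev i).
Proof.
have [_ CN _] := flagP _ _ flagNC.
apply: (iffP idP) => [lt1|[U CU Ui]].
  apply/depth_gt0; rewrite -(ltn_add2r 1) add0n; apply: leq_trans lt1 _.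
  by rewrite leq_add2l leq_b1.
by rewrite /level (CN _ _ CU Ui) addn1 ltnS; apply/depth_gt0; exists U.
Qed.

Lemma upper_in i : 1 < lev i -> upper N C i \in C.
Proof.
have [C0 CN Cc] := flagP _ _ flagNC => /level_ge2[U0 CU0 U0i].
(* The upper set of [i] is the smallest member of the chain that contains [i]. *)
have [U /andP[CU Ui] Umin] := @arg_minnP _ U0 (fun U => (U \in C) && (i \in U))
  (fun U => #|U|) (introT andP (conj CU0 U0i)).
suff -> : upper N C i = U by [].
apply/setP => k; rewrite inE; case Uk: (k \in U); last first.
  by apply/negbTE; rewrite -ltnNge (level_lt CU Ui) ?Uk.
rewrite /level (CN _ _ CU Uk) (CN _ _ CU Ui) leq_add2r; apply: subset_leq_card.
apply/subsetP => V; rewrite !inE => /andP[CV Vi]; rewrite CV /=.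
have /orP[/subsetP/(_ k Uk) //|sVU] := Cc U V CU CV.
have /eqP -> // : V == U by rewrite eqEcard sVU Umin // CV.
Qed.

Lemma flag_upper U : U \in C -> exists2 i, 1 < lev i & U = upper N C i.
Proof.
have [C0 _ _] := flagP _ _ flagNC => CU.
have /set0Pn[i0 Ui0] := C0 _ CU.
have [i Ui imin] := @arg_minnP _ i0 (mem U) lev Ui0.
exists i; first by apply/level_ge2; exists U.
apply/setP => k; rewrite inE; case Uk: (k \in U); first by rewrite imin.
by apply/esym/negbTE; rewrite -ltnNge (level_lt CU Ui) ?Uk.
Qed.

Lemma leq_depth_card i : depth C i <= #|C|.
Proof. by apply: subset_leq_card; apply/subsetP => U; rewrite inE => /andP[]. Qed.

End Level.

(** Criterion for membership in the chain: [W] is the upper set of any of its elements of least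
    level. *)
Lemma flag_set_upper_closed N C (W : {set T}) i0 : flag N C ->
    i0 \in W -> (forall i, i \in W -> 1 < level N C i) ->
    (forall i k, i \in W -> k \notin W -> level N C k < level N C i) ->
  W \in C.
Proof.
move=> fl Wi0 W2 Wlt.
have [i Wi imin] := @arg_minnP _ i0 (mem W) (level N C) Wi0.
suff -> : W = upper N C i by apply: upper_in => //; apply: W2.
apply/setP => k; rewrite inE; case Wk: (k \in W); first by rewrite imin.
by apply/esym/negbTE; rewrite -ltnNge Wlt ?Wk.
Qed.

(** These are the depth functions of the flags [(N, C)] with [r] members in [C]. The value 0 may be
    missed when [N] is empty. *)
Definition step_fun N r (f : {ffun T -> 'I_r.+1}) : bool :=
  [forall i in N, f i == ord0] && [forall t, (t != ord0) ==> [exists i, f i == t]].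

Lemma step_funP N r (f : {ffun T -> 'I_r.+1}) :
  reflect ((forall i, i \in N -> f i = ord0) /\
           (forall t, t != ord0 -> exists i, f i = t)) (step_fun N f).
Proof.
apply: (iffP andP) => [[/forall_inP fN /forallP fS]|[fN fS]].
  split=> [i Ni|t t0]; first exact/eqP/fN.
  by have /implyP/(_ t0)/existsP[i /eqP] := fS t; exists i.
split; first by apply/forall_inP => i Ni; rewrite fN.
apply/forallP => t; apply/implyP => t0; have [i <-] := fS t t0.
by apply/existsP; exists i.
Qed.

Definition superlevel r (f : {ffun T -> 'I_r.+1}) (t : 'I_r.+1) : {set T} :=
  [set k | t <= f k].
Definition flag_of r (f : {ffun T -> 'I_r.+1}) : {set {set T}} :=
  [set superlevel f t | t in [set~ ord0]].

Lemma superlevel_inj N r (f : {ffun T -> 'I_r.+1}) : step_fun N f ->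
  {in [set~ ord0] &, injective (superlevel f)}.
Proof.
move=> /step_funP[_ fS] s t; rewrite !inE => s0 t0 /setP est.
have [i fi] := fS _ s0; have [j fj] := fS _ t0.
have := est i; have := est j; rewrite !inE fi fj !leqnn => st ts.
by apply/val_inj/eqP; rewrite eqn_leq /= st -ts.
Qed.

Lemma card_flag_of N r (f : {ffun T -> 'I_r.+1}) : step_fun N f -> #|flag_of f| = r.
Proof.
move=> fS; rewrite (card_in_imset (superlevel_inj fS)).
by have := cardsC1 (@ord0 r); rewrite card_ord.
Qed.

Lemma flag_flag_of N r (f : {ffun T -> 'I_r.+1}) : step_fun N f -> flag N (flag_of f).
Proof.
move=> /step_funP[fN fS]; apply/flagP; split.
- move=> _ /imsetP[t +->]; rewrite !inE => /fS[i fi].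
  by apply/set0Pn; exists i; rewrite inE fi.
- move=> _ i /imsetP[t +->]; rewrite !inE -val_eqE /= -lt0n => t0.
  by apply: contraL => /fN ->; rewrite -ltnNge.
- move=> _ _ /imsetP[s _ ->] /imsetP[t _ ->].
  case/orP: (leq_total s t) => st; apply/orP; [right|left]; apply/subsetP => k;
    by rewrite !inE; apply: leq_trans.
Qed.

Lemma depth_flag_of N r (f : {ffun T -> 'I_r.+1}) i : step_fun N f ->
  depth (flag_of f) i = f i.
Proof.
move=> fS; pose D := [set t : 'I_r.+1 | 0 < t <= f i].
have -> : depth (flag_of f) i = #|[set superlevel f t | t in D]|.
  apply: eq_card => U; rewrite !inE; apply/andP/imsetP => [[/imsetP[t t0 ->]]|[t + ->]].
    by move: t0; rewrite !inE -val_eqE /= -lt0n => t0 ti; exists t; rewrite ?inE ?t0.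
  rewrite !inE => /andP[t0 ti]; split=> //; apply: imset_f.
  by rewrite !inE -val_eqE /= -lt0n.
rewrite card_in_imset => [|s t]; last first.
  rewrite !inE => /andP[s0 _] /andP[t0 _]; apply: (superlevel_inj fS).
    by rewrite !inE -val_eqE /= -lt0n.
  by rewrite !inE -val_eqE /= -lt0n.
have fi_lt := ltn_ord (f i).
have : #|[set t : 'I_r.+1 | t <= f i]| = (f i).+1.
  rewrite -sum1_card (eq_bigl (fun t : 'I_r.+1 => t < (f i).+1)) => [|t]; last by rewrite inE.
  by rewrite (big_ord_narrow fi_lt) sum1_card card_ord.
rewrite (cardsD1 ord0) inE leq0n add1n => -[<-].
by apply: eq_card => t; rewrite !inE -val_eqE /= -lt0n.
Qed.

Lemma flag_of_inj N r : {in [set f | step_fun N f] &, injective (@flag_of r)}.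
Proof.
move=> f g; rewrite !inE => fS gS efg; apply/ffunP => i; apply: val_inj.
by rewrite /= -(depth_flag_of i fS) -(depth_flag_of i gS) efg.
Qed.

Lemma flag_of_depth N C r : flag N C -> #|C| = r ->
  exists2 f : {ffun T -> 'I_r.+1}, step_fun N f & C = flag_of f.
Proof.
move=> fl cC; pose f : {ffun T -> 'I_r.+1} := [ffun i => inord (depth C i)].
have fE i : f i = depth C i :> nat.
  by rewrite ffunE inordK // ltnS -cC; apply: leq_depth_card.
have upE i : 1 < level N C i -> f i != ord0 /\ upper N C i = superlevel f (f i).
  have [_ CN _] := flagP _ _ fl.
  move=> i2; have /(level_ge2 fl)[U CU Ui] := i2.
  have di : 0 < depth C i by apply/depth_gt0; exists U.
  have Ni := CN _ _ CU Ui.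
  split; first by rewrite -val_eqE /= fE -lt0n.
  apply/setP => k; rewrite !inE !fE /level Ni.
  (* Outside [N], level is depth plus one. On [N] both are 0, and both comparisons fail because [i]
     has positive depth. *)
  case Nk : (k \in N); last by rewrite leq_add2r.
  have : level N C k == 0 by rewrite level_eq0.
  rewrite /level addn_eq0 => /andP[/eqP -> _].
  by rewrite addn1 addn0 leqn0 -[in RHS](prednK di).
have sub : C \subset flag_of f.
  apply/subsetP => U /(flag_upper fl)[i i2 ->]; have [fi0 ->] := upE i i2.
  by apply: imset_f; rewrite !inE.
(* [flag_of f] has at most [r] members, so the inclusion is an equality and the superlevel sets at
   nonzero thresholds are distinct. Each is also the superlevel set at some [f i], so every nonzero
   value is taken. *)
have le_card : #|flag_of f| <= r.
  by have := leq_imset_card (superlevel f) [set~ ord0]; rewrite cardsC1 card_ord.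
have defC : C = flag_of f by apply/eqP; rewrite eqEcard sub cC.
exists f => //; apply/step_funP; split=> [i Ni|t t0].
  have : level N C i == 0 by rewrite level_eq0.
  rewrite /level addn_eq0 => /andP[/eqP di _].
  by apply: val_inj; rewrite /= fE.
have inj : {in [set~ ord0] &, injective (superlevel f)}.
  apply/imset_injP; rewrite -/(flag_of f) -defC cC.
  by have := cardsC1 (@ord0 r); rewrite card_ord => ->.
have : superlevel f t \in C by rewrite defC; apply: imset_f; rewrite !inE.
move=> /(flag_upper fl)[i /upE[fi0 ->]] /inj e.
by exists i; rewrite e ?inE.
Qed.

Lemma card_flags_step N r :
  #|[set C | flag N C && (#|C| == r)]|
  = #|[set f : {ffun T -> 'I_r.+1} | step_fun N f]|.
Proof.
rewrite -(card_in_imset (@flag_of_inj N r)); apply: eq_card => C.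
rewrite !inE; apply/andP/imsetP => [[fl /eqP/(flag_of_depth fl)[f fS ->]]|[f + ->]].
  by exists f; rewrite ?inE.
by rewrite inE => fS; rewrite flag_flag_of // (card_flag_of fS).
Qed.

(** The points of [N] all go to 0 and can be forgotten; the extra point [None], also sent to 0,
    turns the remaining functions into pointed surjections. *)
Lemma card_step_fun N r :
  #|[set f : {ffun T -> 'I_r.+1} | step_fun N f]|
  = r`! * stirling2 (#|~: N| + 1) r.+1.
Proof.
pose A := {i | i \notin N}.
have -> : #|~: N| + 1 = #|{: option A}|.
  by rewrite card_option card_sig addn1; congr _.+1; apply: eq_card => i; rewrite !inE.
rewrite -(card_surj_pointed (None : option A)).
pose h (f : {ffun option A -> 'I_r.+1}) : {ffun T -> 'I_r.+1} :=
  [ffun i => f (insub i)].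
rewrite -(@card_in_imset _ _ h) => [|f g]; last first.
  rewrite !inE => /andP[_ /eqP f0] /andP[_ /eqP g0] /ffunP efg.
  apply/ffunP => -[i|]; last by rewrite f0 g0.
  by have := efg (val i); rewrite !ffunE valK.
apply: eq_card => f; rewrite inE; apply/step_funP/imsetP.
  move=> [fN fS]; exists [ffun x => if x is Some i then f (val i) else ord0].
    rewrite inE ffunE eqxx andbT; apply/surjbP => t.
    have [->|t0] := eqVneq t ord0; first by exists None; rewrite ffunE.
    have [i fi] := fS t t0.
    have Ni : i \notin N by apply: contraNN t0 => /fN; rewrite fi => ->.
    by exists (Some (Sub i Ni)); rewrite ffunE SubK.
  apply/ffunP => i; rewrite !ffunE; case: insubP => [j _ -> //|].
  by rewrite negbK => /fN.
move=> [g + ->]; rewrite inE => /andP[/surjbP gS /eqP g0]; split.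
  by move=> i Ni; rewrite ffunE insubF ?Ni.
move=> t t0; have [[i|] gi] := gS t; last by rewrite -gi g0 eqxx in t0.
by exists (val i); rewrite ffunE valK.
Qed.

Lemma card_flags N r :
  #|[set C | flag N C && (#|C| == r)]| = r`! * stirling2 (#|~: N| + 1) r.+1.
Proof. by rewrite card_flags_step card_step_fun. Qed.

End Flags.

(** * Counting flags, and the reducible ones among them *)

Section FlagCount.
Variable T : finType.
Implicit Types (N U V : {set T}) (C : {set {set T}}) (x y : T).
Implicit Types (c : {set T} * {set {set T}}).

(** The number [d] is the codimension of the face of a flag that is not discarded. *)
Definition codes (d : nat) : {set {set T} * {set {set T}}} :=
  [set c | flag c.1 c.2 && (#|c.1| + #|c.2| == d)].

(** Sum over [N] the number of chains in its complement, then group by [j = #|N|]. The predicate [P]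
    serves both cases of the theorem: every [j], or [j != 1]. *)
Lemma card_codes (d : nat) (P : pred nat) :
  #|[set c in codes d | P #|c.1|]|
  = \sum_(0 <= j < d.+1 | P j)
      'C(#|T|, j) * (d - j)`! * stirling2 (#|T| - j + 1) (d - j + 1).
Proof.
pose a j := (d - j)`! * stirling2 (#|T| - j + 1) (d - j + 1).
have -> : #|[set c in codes d | P #|c.1|]| = \sum_(N : {set T} | (#|N| < d.+1) && P #|N|) a #|N|.
  rewrite -sum1_card.
  rewrite (eq_bigl (fun c => ((#|c.1| < d.+1) && P #|c.1|) &&
              (flag c.1 c.2 && (#|c.2| == d - #|c.1|)))) => [|c]; last first.
    rewrite !inE andbAC -andbA [RHS]andbCA; congr (_ && _).
    case: (P _); rewrite ?andbF ?andbT //= ltnS.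
    apply/eqP/andP => [<-|[le_d /eqP ->]]; last by rewrite subnKC.
    by rewrite leq_addr addKn.
  rewrite -(pair_big_dep (fun N : {set T} => (#|N| < d.+1) && P #|N|)
      (fun N C => flag N C && (#|C| == d - #|N|)) (fun _ _ => 1)) /=.
  apply: eq_bigr => N _; rewrite -(eq_bigl _ _ (fun C => in_set _ C)) sum1_card.
  by rewrite card_flags (cardsCs (~: N)) setCK addn1 /a !addn1.
rewrite (partition_big (fun N : {set T} => inord #|N| : 'I_d.+1) (fun j => P j)) /=; last first.
  by move=> N /andP[lt_d PN]; rewrite inordK.
rewrite big_mkord; apply: eq_bigr => j Pj.
rewrite -mulnA -/(a j) -card_draws -sum_nat_const; apply/esym.
rewrite [LHS](eq_bigr (fun N : {set T} => a #|N|)) => [|N]; last first.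
  by rewrite inE => /eqP->.
apply: eq_bigl => N; rewrite inE; apply/eqP/andP => [->|[/andP[lt_d _] /eqP <-]].
  by rewrite ltn_ord Pj; split=> //; apply/eqP/val_inj; rewrite /= inordK.
by rewrite inordK.
Qed.

Definition reducible c : bool := (c.1 == set0) && [exists x, [set~ x] \in c.2].

(* A bijection from the flags with [N = [set x]] to the reducible ones. *)
Definition merge_coatom c : {set T} * {set {set T}} :=
  (set0, (if ~: c.1 \in c.2 then setT else ~: c.1) |: c.2).

Lemma flag_coatom_inj N C x y : flag N C ->
  [set~ x] \in C -> [set~ y] \in C -> x = y.
Proof.
move=> /flagP[_ _ Cc] Cx Cy.
by have := Cc _ _ Cx Cy; rewrite !setCS !sub1set !inE => /orP[] /eqP.
Qed.

Lemma setT_merge_coatom N C x : flag N C -> N = [set x] -> 1 < #|T| ->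
  (setT \in (merge_coatom (N, C)).2) = (~: N \in C).
Proof.
move=> /flagP[_ CN _] defN T2 /=; subst N.
case: ifP => // Cx; first by rewrite !inE eqxx.
rewrite !inE; apply/negbTE; rewrite negb_or; apply/andP; split.
  by apply/eqP => /setP/(_ x); rewrite !inE eqxx.
by apply/negP => /CN/(_ (in_setT x)); rewrite inE eqxx.
Qed.

(** [merge_coatom] trades the single point of [N] for one new member of the chain, which preserves
    [#|N| + #|C|]: the complement of the point, or the whole set if that complement is already
    there. *)
Lemma card_reducible (d : nat) : 1 < #|T| ->
  #|[set c in codes d | reducible c]| = #|[set c in codes d | #|c.1| == 1]|.
Proof.
move=> T2; apply: esym.
have notinC N C x U : flag N C -> N = [set x] -> x \in U -> U \notin C.
  move=> /flagP[_ CN _] defN Ux; subst N; apply/negP => /CN/(_ Ux).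
  by rewrite inE eqxx.
have coatom_in N C : ~: N \in (merge_coatom (N, C)).2.
  by rewrite /merge_coatom /=; case: ifP => CN; rewrite !inE ?CN ?eqxx ?orbT.
have flag_merge N C x : flag N C -> N = [set x] -> flag set0 (merge_coatom (N, C)).2.
  move=> fl defN; have [C0 CN Cc] := flagP _ _ fl.
  set W := if ~: N \in C then setT else ~: N.
  have W0 : W != set0.
    rewrite /W; case: ifP => _; first by rewrite -card_gt0 cardsT ltnW.
    by rewrite -card_gt0 defN cardsC1 -ltnS prednK // ltnW.
  have subW U : U \in C -> U \subset W.
    rewrite /W; case: ifP => [_ _|_ CU]; first exact: subsetT.
    by apply/subsetP => y Uy; rewrite inE (CN _ _ CU Uy).
  apply/flagP; split=> [U|U y _ _|U V]; rewrite ?inE //.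
    by move=> /orP[/eqP->|/C0].
  move=> /orP[/eqP->|CU] /orP[/eqP->|CV]; rewrite ?subxx ?(subW _ CV) ?(subW _ CU) ?orbT //.
  exact: Cc.
have card_merge N C x : flag N C -> N = [set x] ->
    #|(merge_coatom (N, C)).2| = #|C|.+1.
  move=> fl defN; rewrite /= cardsU1; case: ifP => CN; last by rewrite CN.
  by rewrite (notinC _ _ _ _ fl defN) ?inE.
rewrite -(@card_in_imset _ _ merge_coatom) => [|[N C] [N' C']]; last first.
  rewrite !inE /= => /andP[/andP[fl _] /cards1P[x defN]] /andP[/andP[fl' _] /cards1P[y defN']] [].
  rewrite -/(merge_coatom (N, C)).2 -/(merge_coatom (N', C')).2 => eC.
  (* A chain contains at most one complement of a point, so the image determines [N]; whether it
     contains the whole set then tells which member was added. *)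
  have exy : x = y.
    apply: (flag_coatom_inj (flag_merge _ _ _ fl defN)).
      by rewrite -defN coatom_in.
    by rewrite -defN' /= eC; apply: coatom_in.
  have eN : N' = N by rewrite defN defN' exy.
  rewrite eN in fl' defN' eC *; congr (_, _).
  have eT : (~: N \in C) = (~: N \in C').
    by rewrite -(setT_merge_coatom fl defN T2) -(setT_merge_coatom fl' defN T2) /= eC.
  move: eC; rewrite -eT; case: ifP => CN eC.
    rewrite -(setU1K (notinC _ _ _ setT fl defN (in_setT _))) eC setU1K //.
    exact: (notinC _ _ _ setT fl' defN (in_setT _)).
  by rewrite -(setU1K (negbT CN)) eC setU1K // -eT CN.
apply: eq_card => -[N' C']; rewrite !inE /=.
apply/imsetP/andP => [[[N C] +]|[/andP[fl cC] /andP[/eqP/= N0 /existsP[x Cx]]]].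
  rewrite !inE /= => /andP[/andP[fl cC] /cards1P[x defN]].
  case=> -> eC; rewrite {}eC -/(merge_coatom (N, C)).2; split; last first.
    by rewrite /reducible eqxx; apply/existsP; exists x; rewrite -defN coatom_in.
  rewrite (flag_merge _ _ _ fl defN) (card_merge _ _ _ fl defN) cards0 add0n.
  by rewrite defN cards1 add1n in cC.
subst N'; rewrite cards0 add0n in cC; have [C0 CN Cc] := flagP _ _ fl.
have ne_xT : [set~ x] != setT :> {set T}.
  by apply/eqP => /setP/(_ x); rewrite !inE eqxx.
pose W := if setT \in C' then setT else [set~ x].
have CW : W \in C' by rewrite /W; case: ifP.
(* Such a [U] is comparable with the complement of [x], so it contains it. Removing [W] therefore
   leaves only sets that avoid [x]. *)
have sub U : U \in C' -> x \in U -> U = setT.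
  move=> CU Ux; apply/eqP; rewrite eqEsubset subsetT /= -(setUCr [set x]) subUset sub1set Ux /=.
  by have /orP[/subsetP/(_ x Ux)|] := Cc _ _ CU Cx; rewrite // !inE eqxx.
exists ([set x], C' :\ W).
  rewrite !inE /= cards1 eqxx andbT add1n.
  have -> : #|C' :\ W|.+1 = #|C'| by rewrite [RHS](cardsD1 W) CW.
  rewrite cC andbT; apply/flagP; split=> [U|U y|U V]; rewrite !inE.
  - by move=> /andP[_ /C0].
  - move=> /andP[UW CU] Uy; apply: contraNneq UW => exy; subst y.
    have UT := sub _ CU Uy; rewrite UT /W; case: ifP => //.
    by rewrite -UT CU.
  - by move=> /andP[_ CU] /andP[_ CV]; apply: Cc.
rewrite /merge_coatom /= !inE Cx andbT; congr (_, _).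
rewrite /W; case: (boolP (setT \in C')) => CT; first by rewrite ne_xT setD1K.
by rewrite eqxx setD1K.
Qed.

Lemma card_irreducible (d : nat) : 1 < #|T| ->
  #|[set c in codes d | ~~ reducible c]| = #|[set c in codes d | #|c.1| != 1]|.
Proof.
move=> T2; apply/eqP.
have split_card (P : pred ({set T} * {set {set T}})) :
    #|[set c in codes d | P c]| + #|[set c in codes d | ~~ P c]| = #|codes d|.
  rewrite -(cardsID [set c | P c] (codes d)); congr (_ + _);
    by apply: eq_card => c; rewrite !inE // andbC.
have := split_card reducible; rewrite -(split_card (fun c => #|c.1| == 1)).
by rewrite card_reducible // => /addnI/eqP.
Qed.

End FlagCount.

(** * Parking functions and permutations *)

Section Parking.
Variables (n : nat) (b : n.-tuple nat).
Hypothesis b_gt0 : forall i : 'I_n, 0 < tnth b i.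

Definition bsum (p : 'I_n) : nat := \sum_(j < n | j <= p) tnth b j.

Lemma bsumE (p q : 'I_n) : p < q ->
  bsum q = bsum p + \sum_(j < n | p < j <= q) tnth b j.
Proof.
move=> lt_pq; rewrite /bsum (bigID (fun j : 'I_n => j <= p)) /=; congr (_ + _);
  by apply: eq_bigl => j; lia.
Qed.

Lemma bsum_lt (p q : 'I_n) : p < q -> bsum p < bsum q.
Proof.
move=> lt_pq; rewrite (bsumE lt_pq) -[X in X < _]addn0 ltn_add2l.
by rewrite (bigD1 q) ?lt_pq ?leqnn //= addn_gt0 b_gt0.
Qed.

Lemma bsum_leq (p q : 'I_n) : p <= q -> bsum p <= bsum q.
Proof.
rewrite leq_eqVlt => /orP[/eqP/val_inj -> //|lt_pq].
exact/ltnW/bsum_lt.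
Qed.

Lemma bsum_inj : injective bsum.
Proof.
move=> p q epq; apply: val_inj.
have [lt_pq|lt_qp|//] := ltngtP (val p) (val q).
  by have := bsum_lt lt_pq; rewrite epq ltnn.
by have := bsum_lt lt_qp; rewrite epq ltnn.
Qed.

Lemma bsum_gt0 p : 0 < bsum p.
Proof. by rewrite /bsum (bigD1 p) //= addn_gt0 b_gt0. Qed.

Lemma bsum0 (p : 'I_n) : val p = 0 -> bsum p = nth 0 b 0.
Proof.
move=> p0; rewrite /bsum (big_pred1 p) => [|j]; first by rewrite (tnth_nth 0) p0.
by apply/idP/eqP => [|->]; [move=> le_jp; apply: val_inj; move: p0 le_jp => /=; lia | exact: leqnn].
Qed.

Lemma bsum_ge_head (p : 'I_n) : nth 0 b 0 <= bsum p.
Proof.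
have n0 : 0 < n by apply: leq_trans (ltn_ord p).
by rewrite -(bsum0 (p := Ordinal n0)) // bsum_leq.
Qed.

Lemma bsum_ge2 (p : 'I_n) : 0 < p -> 1 < bsum p.
Proof.
move=> p0; have n0 : 0 < n by apply: leq_trans (ltn_ord p).
exact: leq_ltn_trans (bsum_gt0 (Ordinal n0)) (bsum_lt _).
Qed.

Definition top_ords (k : nat) : {set 'I_n} := [set p : 'I_n | n - k <= p].
Definition top_sum (k : nat) : nat := \sum_(p in top_ords k) bsum p.

Lemma card_top_ords k : k <= n -> #|top_ords k| = k.
Proof.
move=> le_kn.
have : #|~: top_ords k| = n - k.
  rewrite -sum1_card (eq_bigl (fun p : 'I_n => p < n - k)) => [|p]; last first.
    by rewrite !inE -ltnNge.
  by rewrite (big_ord_narrow (leq_subr k n)) sum1_card card_ord.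
by have := cardsC (top_ords k); rewrite card_ord; lia.
Qed.

(** Exchange argument: [D :\: W] and [W :\: D] have equally many elements, and every index of the
    former exceeds every index of the latter. The least index [q] of [D :\: W] separates the two
    sums. *)
Lemma sum_bsum_lt (W : {set 'I_n}) :
  W != top_ords #|W| -> \sum_(p in W) bsum p < top_sum #|W|.
Proof.
set D := top_ords _ => neWD.
have cD : #|D| = #|W| by rewrite card_top_ords // -[n in _ <= n]card_ord max_card.
have cDW : #|D :\: W| = #|W :\: D|.
  by have := cardsID W D; have := cardsID D W; rewrite setIC cD; lia.
have /set0Pn[p0 p0D] : D :\: W != set0.
  apply: contraNneq neWD => e0; rewrite eqEcard cD leqnn andbT -setD_eq0 -cards_eq0.
  by rewrite -cDW e0 cards0.
have [q qDW qmin] := @arg_minnP _ p0 (mem (D :\: W)) val p0D.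
rewrite /top_sum -/D (big_setID D) /= [X in _ < X](big_setID W) /= setIC ltn_add2l.
apply: (@leq_trans (#|W :\: D| * bsum q)); last first.
  rewrite -cDW -sum_nat_const; apply: leq_sum => p pDW.
  exact/bsum_leq/qmin.
have ltq p : p \in W :\: D -> bsum p < bsum q.
  move=> pWD; apply: bsum_lt; move: pWD qDW; rewrite !inE; lia.
have W0 : 0 < #|W :\: D| by rewrite -cDW card_gt0; apply/set0Pn; exists p0.
have : \sum_(p in W :\: D) (bsum p).+1 <= #|W :\: D| * bsum q.
  by rewrite -sum_nat_const; apply: leq_sum.
under eq_bigr do rewrite -addn1.
rewrite big_split /= sum1_card => le_q; apply: leq_trans le_q.
by rewrite -[X in X < _]addn0 ltn_add2l.
Qed.

Lemma sum_bsum_leq (W : {set 'I_n}) : \sum_(p in W) bsum p <= top_sum #|W|.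
Proof.
have [eWD|neWD] := eqVneq W (top_ords #|W|); first by rewrite {1}eWD.
exact/ltnW/sum_bsum_lt.
Qed.

Lemma sum_perm_leq (s : {perm 'I_n}) (U : {set 'I_n}) :
  \sum_(i in U) bsum (s i) <= top_sum #|U|.
Proof.
rewrite -(card_imset (mem U) (@perm_inj _ s)) -(big_imset bsum) /=.
  exact: sum_bsum_leq.
by move=> i j _ _; apply: perm_inj.
Qed.

(** The image of [U] contains [s i] but not the larger [s j], so it does not consist of the top
    indices. *)
Lemma sum_perm_lt (s : {perm 'I_n}) (U : {set 'I_n}) (i j : 'I_n) :
    i \in U -> j \notin U -> s i < s j ->
  \sum_(i in U) bsum (s i) < top_sum #|U|.
Proof.
move=> Ui Uj lt_ij.
rewrite -(card_imset (mem U) (@perm_inj _ s)) -(big_imset bsum) /=; last first.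
  by move=> k l _ _; apply: perm_inj.
apply: sum_bsum_lt; apply: contraNneq Uj => eU.
rewrite -(mem_imset _ _ (@perm_inj _ s)) eU inE.
have : s i \in s @: U by apply: imset_f.
by rewrite {1}eU inE => /leq_trans; apply; apply: ltnW.
Qed.

Lemma sum_perm_top (s : {perm 'I_n}) (U : {set 'I_n}) :
    (forall i j, i \in U -> j \notin U -> s j < s i) ->
  \sum_(i in U) bsum (s i) = top_sum #|U|.
Proof.
move=> sU; rewrite -(card_imset (mem U) (@perm_inj _ s)) -(big_imset bsum) /=; last first.
  by move=> k l _ _; apply: perm_inj.
suff {1}-> : s @: U = top_ords #|s @: U| by [].
have cU : #|s @: U| <= n by rewrite -[n in _ <= n]card_ord max_card.
apply/eqP; rewrite eqEcard card_top_ords // leqnn andbT; apply/subsetP => p pU.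
(* The image of [U] is closed upwards, so it contains the [n - p] indices from [p] on; hence [p] is
   at least [n] minus its size. *)
rewrite inE; have : #|[set q : 'I_n | p <= q]| <= #|s @: U|.
  apply/subset_leq_card/subsetP => q; rewrite inE => le_pq.
  have [i Ui def_p] := imsetP pU.
  rewrite -(permKV s q) mem_imset; last exact: perm_inj.
  apply: contraTT le_pq => Uq; rewrite -ltnNge def_p.
  by have := sU _ _ Ui Uq; rewrite permKV.
have -> : [set q : 'I_n | p <= q] = top_ords (n - p).
  by apply/setP => q; rewrite !inE subKn // ltnW.
by rewrite card_top_ords ?leq_subr //; lia.
Qed.

Lemma exists_perm_homo (g : 'I_n -> nat) :
  exists s : {perm 'I_n}, forall i j, g i < g j -> s i < s j.
Proof.
(* Sort by [g], breaking ties by index; the position of [i] is the number of smaller keys. *)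
pose key (i : 'I_n) := g i * n + i.
have key_inj i j : key i = key j -> i = j.
  move=> /(congr1 (modn^~ n)); rewrite /key !modnMDl !modn_small ?ltn_ord //.
  exact: val_inj.
pose below i := [set j | key j < key i].
have below_lt i : #|below i| < n.
  rewrite -[n in _ < n]card_ord -cardsT; apply: proper_card.
  by rewrite properT; apply/eqP => /setP/(_ i); rewrite !inE ltnn.
pose pos i := Ordinal (below_lt i).
have pos_lt i j : key i < key j -> pos i < pos j.
  move=> lt_ij; apply: proper_card; apply/properP; split.
    by apply/subsetP => k; rewrite !inE => /ltn_trans; apply.
  by exists i; rewrite !inE ?ltnn.
have pos_inj : injective pos.
  move=> i j epos; apply: key_inj; apply/eqP.
  by case: ltngtP => // /pos_lt; rewrite epos ltnn.
exists (perm pos_inj) => i j lt_g; rewrite !permE; apply: pos_lt.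
rewrite /key; have := leq_mul lt_g (leqnn n); have := ltn_ord i; lia.
Qed.

Lemma sort_tuple_perm (beta : n.-tuple nat) :
  exists t : {perm 'I_n}, forall p : 'I_n, nth 0 (sort leq beta) p = tnth beta (t p).
Proof.
have /tuple_permP[t def_t] : perm_eq (sort leq beta) beta by rewrite perm_sort.
by exists t => p; rewrite def_t nth_mktuple.
Qed.

(** Replaces sorting by a matching of the entries with distinct partial sums that bound them. *)
Lemma parking_functionP (beta : n.-tuple nat) :
  parking_function b beta <->
  (forall i, 0 < tnth beta i) /\
  exists s : {perm 'I_n}, forall i, tnth beta i <= bsum (s i).
Proof.
have [t tE] := sort_tuple_perm beta.
split=> [[beta_gt0 le_sort]|[beta_gt0 [s le_s]]]; split=> //.
  exists (t^-1)%g => i; have := le_sort ((t^-1)%g i); rewrite -/(bsum _).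
  by rewrite tE permKV.
move=> p; rewrite -/(bsum p) leqNgt; apply/negP => lt_p.
(* Pigeonhole: if the sorted entry at [p] is too large, so are the later ones, and these [n - p]
   entries must be matched with the [n - p - 1] indices beyond [p]. *)
have lt_st (q : 'I_n) : p <= q -> p < s (t q).
  move=> le_pq; rewrite ltnNge; apply/negP => /bsum_leq le_B.
  have le_sort : nth 0 (sort leq beta) p <= nth 0 (sort leq beta) q.
    apply: (sorted_leq_nth leq_trans leqnn) => //.
    - exact: sort_sorted leq_total _.
    - by rewrite inE size_sort size_tuple.
    - by rewrite inE size_sort size_tuple.
  have := leq_trans (le_s (t q)) le_B; apply/negP; rewrite -ltnNge.
  by apply: leq_trans lt_p _; rewrite -tE.
have : #|[set s (t q) | q in top_ords (n - p)]| <= #|top_ords (n - p.+1)|.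
  apply/subset_leq_card/subsetP => _ /imsetP[q + ->].
  by rewrite !inE !subKn ?ltn_ord // ?(ltnW (ltn_ord p)) //; apply: lt_st.
rewrite card_imset; last by apply: inj_comp; apply: perm_inj.
by rewrite !card_top_ords ?leq_subr //; have := ltn_ord p; lia.
Qed.

End Parking.

Import Order.TTheory GRing.Theory Num.Theory.
Local Open Scope ring_scope.

(** * Faces of the parking polytope *)

Section FlagFaces.
Variables (R : realType) (n : nat) (b : n.-tuple nat).
Hypothesis b_gt0 : forall i : 'I_n, (0 < tnth b i)%N.
Implicit Types (N U L : {set 'I_n}) (C : {set {set 'I_n}}) (x : 'rV[R]_n).

Local Notation P := (parking_polytope R b).

(** A half-space is convex, so it contains the hull as soon as it contains the parking functions. *)
Lemma parking_polytope_halfspace (a : 'I_n -> R) (c : R) :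
    (forall beta, parking_function b beta -> \sum_i a i * (tnth beta i)%:R <= c) ->
  forall x, P x -> \sum_i a i * x 0 i <= c.
Proof.
move=> le_c x Px; pose H : classical_sets.set 'rV[R]_n := fun x => \sum_i a i * x 0 i <= c.
have cvxH : convex.convex_set H.
  move=> y z t; rewrite !classical_sets.in_setE /H => Hy Hz.
  rewrite (eq_bigr (fun i => t%:num * (a i * y 0 i) + (1 - t%:num) * (a i * z 0 i))).
    rewrite big_split /= -!mulr_sumr.
    have t0 : 0 <= t%:num by [].
    have t1 : 0 <= 1 - t%:num by rewrite subr_ge0.
    have := ler_wpM2l t0 Hy; have := ler_wpM2l t1 Hz; lra.
  by move=> i _; rewrite !mxE /unstable.onem; lra.
apply: (classical_sets.smallest_sub cvxH _ Px).
move=> _ [beta pf <-]; rewrite /H.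
by under eq_bigr do rewrite mxE; apply: le_c.
Qed.

Lemma parking_polytope_ge1 x i : P x -> 1 <= x 0 i.
Proof.
move=> Px; rewrite -lerN2.
have -> : - x 0 i = \sum_j (- (j == i)%:R) * x 0 j.
  rewrite (bigD1 i) //= eqxx mulN1r big1 ?addr0 // => j /negbTE ->.
  by rewrite oppr0 mul0r.
apply: parking_polytope_halfspace Px => beta [beta_gt0 _].
rewrite (bigD1 i) //= eqxx mulN1r big1 ?addr0 => [|j /negbTE ->].
  by rewrite lerN2 ler1n.
by rewrite oppr0 mul0r.
Qed.

Lemma sum_indicator U (f : 'I_n -> R) :
  \sum_(i in U) f i = \sum_i (i \in U)%:R * f i.
Proof.
by rewrite big_mkcond /=; apply: eq_bigr => i _; case: ifP; rewrite ?mul1r ?mul0r.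
Qed.

Lemma parking_polytope_top x U : P x -> \sum_(i in U) x 0 i <= (top_sum b #|U|)%:R.
Proof.
move=> Px; rewrite sum_indicator; apply: parking_polytope_halfspace Px => beta.
move=> /(parking_functionP b_gt0)[_ [s le_s]].
rewrite -(sum_indicator U (fun i => (tnth beta i)%:R)) -natr_sum ler_nat.
by apply: leq_trans (sum_perm_leq b_gt0 s U); apply: leq_sum.
Qed.

(** Test points for the tightness of the bounds; for some [s] and [L] they are not extreme
    points. *)
Definition vertex (s : {perm 'I_n}) L : 'rV[R]_n :=
  \row_i (if i \in L then 1%N else bsum b (s i))%:R.

Lemma vertex_in (s : {perm 'I_n}) L : P (vertex s L).
Proof.
apply: classical_sets.sub_gen_smallest.
exists [tuple (if i \in L then 1%N else bsum b (s i)) | i < n].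
  apply/(parking_functionP b_gt0); split=> [i|].
    by rewrite tnth_mktuple; case: ifP => // _; apply: bsum_gt0.
  exists s => i; rewrite tnth_mktuple; case: ifP => // _; exact: bsum_gt0.
by apply/rowP => i; rewrite !mxE tnth_mktuple.
Qed.

Definition flag_face N C : classical_sets.set 'rV[R]_n := fun x =>
  [/\ P x, forall i, i \in N -> x 0 i = 1
    & forall U, U \in C -> \sum_(i in U) x 0 i = (top_sum b #|U|)%:R].

(** Since [s] respects levels, each member of [C] receives the largest partial sums, and [L] lowers
    none of its coordinates. *)
Lemma vertex_in_flag_face N C (s : {perm 'I_n}) L : flag N C ->
    (forall i j, (level N C i < level N C j)%N -> (s i < s j)%N) ->
    N \subset L -> (forall i, i \in L -> (level N C i <= 1)%N) ->
  flag_face N C (vertex s L).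
Proof.
move=> fl s_mono /subsetP sNL L1; split=> [|i /sNL Li|U CU].
- exact: vertex_in.
- by rewrite mxE Li.
- have UL i : i \in U -> i \notin L.
    by move=> Ui; apply/negP => /L1; rewrite leqNgt => /negP; apply; apply/(level_ge2 fl); exists U.
  under eq_bigr => i Ui do rewrite mxE (negbTE (UL i Ui)).
  rewrite -natr_sum sum_perm_top // => i j Ui Uj.
  by apply: s_mono; apply: (level_lt fl CU).
Qed.

(* If b_1 = 1, the reducible flags are excluded: they define the same faces as
   flags with [N] a singleton. *)
Definition proper_flag N C : bool :=
  flag N C && ((1 < nth 0 b 0)%N || (1 < n)%N && ~~ reducible (N, C)).

Section Proper.
Variables (N : {set 'I_n}) (C : {set {set 'I_n}}).
Hypothesis pNC : proper_flag N C.
Let fl : flag N C. Proof. by case/andP: pNC. Qed.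
Local Notation lev := (level N C).

Lemma exists_perm_raise i : exists s : {perm 'I_n},
  (forall j k, (lev j < lev k)%N -> (s j < s k)%N) /\
  (forall j, j != i -> (lev j <= lev i)%N -> (s j < s i)%N).
Proof.
(* Doubling the levels leaves room to place [i] above its own level and still below the next one. *)
have [s s_mono] := exists_perm_homo (fun k => 2 * lev k + (k == i))%N.
exists s; split=> [j k lt_jk|j ji le_ji]; apply: s_mono; rewrite ?(negbTE ji) ?eqxx; lia.
Qed.

(** The value 1 would need [b_1 = 1] and [s i = 0]. Then all other points have a level above that of
    [i], which is at least 1, so [N] is empty and the complement of [i] belongs to [C]: the flag is
    reducible. *)
Lemma bsum_raise_ge2 i (s : {perm 'I_n}) :
    (forall j, j != i -> (lev j <= lev i)%N -> (s j < s i)%N) ->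
  i \notin N -> (1 < bsum b (s i))%N.
Proof.
move=> s_top Ni; have /andP[_ /orP[b2|/andP[n1 nred]]] := pNC.
  exact: leq_trans b2 (bsum_ge_head b_gt0 _).
have [si0|] := posnP (s i); last exact: bsum_ge2.
have lev_i : (0 < lev i)%N by rewrite lt0n (level_eq0 fl).
have lt_i k : k != i -> (lev i < lev k)%N.
  move=> ki; rewrite ltnNge; apply/negP => /(s_top _ ki).
  by rewrite si0.
case/negP: nred; rewrite /reducible /=; apply/andP; split.
  apply/eqP/setP => k; rewrite inE -(level_eq0 fl); apply/negbTE; rewrite -lt0n.
  by have [-> //|/lt_i] := eqVneq k i; apply: leq_trans.
apply/existsP; exists i.
have [i0 i0i] : exists i0, i0 != i.
  suff /set0Pn[i0] : [set~ i] != set0 by rewrite !inE; exists i0.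
  by rewrite -card_gt0 cardsC1 card_ord; lia.
apply: (@flag_set_upper_closed _ N C _ i0) => //; first by rewrite !inE.
  by move=> k; rewrite !inE => /lt_i; apply: leq_ltn_trans.
by move=> j k; rewrite !inE negbK => ji /eqP ->; apply: lt_i.
Qed.

Lemma in_flag_face_coord i :
  i \in N <-> (forall x, flag_face N C x -> x 0 i = 1).
Proof.
split=> [Ni x [_ + _]|F1]; first exact.
apply: contraT => Ni; have [s [s_mono s_top]] := exists_perm_raise i.
have /F1 : flag_face N C (vertex s N).
  by apply: vertex_in_flag_face => // j; rewrite -(level_eq0 fl) => /eqP ->.
rewrite mxE (negbTE Ni) => /eqP; rewrite pnatr_eq1 => /eqP e1.
by have := bsum_raise_ge2 s_top Ni; rewrite e1.
Qed.

(** With the previous lemma, this recovers the flag from its face. For the converse, test points of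
    the face show that [U] is closed upwards for the level and that its levels exceed 1. *)
Lemma in_flag_face_set U : U \in C <->
  [/\ U != set0, (forall i, i \in U -> i \notin N)
    & forall x, flag_face N C x -> \sum_(i in U) x 0 i = (top_sum b #|U|)%:R].
Proof.
have [C0 CN Cc] := flagP _ _ fl.
split=> [CU|[/set0Pn[i0 Ui0] UN Ftop]].
  by split=> [||x [_ _]]; [apply: C0|move=> i; apply: CN|apply].
have [i Ui imin] := @arg_minnP _ i0 (mem U) lev Ui0.
have lev0 j : j \in N -> (lev j <= 1)%N by rewrite -(level_eq0 fl) => /eqP ->.
have lev_up j : j \notin U -> (lev j < lev i)%N.
  move=> Uj; rewrite ltnNge; apply/negP => le_ij.
  have [s [s_mono s_top]] := exists_perm_raise j.
  have /Ftop : flag_face N C (vertex s N) by apply: vertex_in_flag_face.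
  under eq_bigr => k Uk do rewrite mxE (negbTE (UN k Uk)).
  rewrite -natr_sum => /eqP; rewrite eqr_nat => /eqP e.
  have lt_ij : (s i < s j)%N.
    by apply: s_top => //; apply: contraNneq Uj => <-.
  by have := sum_perm_lt b_gt0 Ui Uj lt_ij; rewrite e ltnn.
have [lev_i|lev_i] := ltnP 1 (lev i).
  apply: (flag_set_upper_closed fl Ui0) => [k /imin|k j Uk Uj]; first exact: leq_trans.
  exact: leq_trans (lev_up _ Uj) (imin _ Uk).
(* Here [i] has level 1, so its coordinate, raised to at least 2, may also be lowered to 1 within
   the face; this makes the sum over [U] smaller than its bound. *)
have Ni := UN i Ui; have [s [s_mono s_top]] := exists_perm_raise i.
have /Ftop : flag_face N C (vertex s (i |: N)).
  apply: vertex_in_flag_face => //; first exact: subsetUr.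
  by move=> k; rewrite !inE => /orP[/eqP -> //|/lev0].
under eq_bigr => k Uk do rewrite mxE !inE (negbTE (UN k Uk)) orbF.
rewrite -natr_sum => /eqP; rewrite eqr_nat => /eqP e.
have := sum_perm_leq b_gt0 s U; rewrite -e leqNgt => /negP[].
rewrite (bigD1 i) //= [X in (_ < X)%N](bigD1 i) //= eqxx.
rewrite (eq_bigr (fun k => bsum b (s k))) => [|k /andP[_ /negbTE -> //]].
by rewrite ltn_add2r bsum_raise_ge2.
Qed.

End Proper.

Lemma flag_face_inj N C N' C' : proper_flag N C -> proper_flag N' C' ->
  flag_face N C = flag_face N' C' -> (N, C) = (N', C').
Proof.
move=> p p' eF; have eN : N = N'.
  apply/setP => i; apply/idP/idP.
    by move=> /(in_flag_face_coord p); rewrite eF => /(in_flag_face_coord p').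
  by move=> /(in_flag_face_coord p'); rewrite -eF => /(in_flag_face_coord p).
congr (_, _) => //; apply/setP => U; apply/idP/idP.
  by move=> /(in_flag_face_set p); rewrite eF eN => /(in_flag_face_set p').
by move=> /(in_flag_face_set p'); rewrite -eF -eN => /(in_flag_face_set p).
Qed.

End FlagFaces.

(** * Decomposition of a linear functional along a flag *)

Section Functional.
Variables (R : realFieldType) (I : finType).

(* Induction on the number of positive values of [a]: subtract the least one on
   the whole set where [a] is positive. *)
Lemma functional_flag (a : I -> R) :
  exists (C : {set {set I}}) (w : {set I} -> R),
  [/\ flag [set i | a i < 0] C,
      forall U, U \in C -> U \subset [set i | 0 < a i],
      forall U, U \in C -> 0 < w U
    & forall x : I -> R, \sum_i a i * x i =
        \sum_(U in C) w U * \sum_(i in U) x i + \sum_(i | a i < 0) a i * x i].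
Proof.
have [m] := ubnP #|[set i | 0 < a i]|; elim: m a => // m IHm a.
set D := [set i | 0 < a i]; rewrite ltnS => le_m.
have [D0|/set0Pn[i0 Di0]] := eqVneq D set0.
  exists set0, (fun=> 0); split=> [|U|U|x]; [|by rewrite inE|by rewrite inE|].
    by apply/flagP; split=> [U|U i|U V]; rewrite in_set0.
  rewrite big_set0 add0r [RHS]big_mkcond /=; apply: eq_bigr => i _.
  have: i \notin D by rewrite D0 inE.
  rewrite inE -leNgt; case: (ltgtP (a i) 0) => // -> _; by rewrite mul0r.
have inD j : (j \in D) = (0 < a j) by rewrite inE.
have [i Di imin] : exists2 i, i \in D & forall j, j \in D -> a i <= a j.
  by case: (arg_minP a Di0) => i Di imin; exists i.
have ai_gt0 : 0 < a i by rewrite -inD.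
pose a' j := a j - (if j \in D then a i else 0).
have neg_a' j : (a' j < 0) = (a j < 0).
  rewrite /a'; case: ifP => Dj; last by rewrite subr0.
  have := imin _ Dj; move: Dj; rewrite inE; lra.
have sub_a' : [set j | 0 < a' j] \subset D :\ i.
  apply/subsetP => j; rewrite in_set /a' in_setD1; case: ifP => Dj aj.
    by rewrite andbT; apply: contraTneq aj => ->; rewrite subrr ltxx.
  by move: aj Dj; rewrite subr0 inE => ->.
have lt_m : (#|[set j | (0 < a' j)%R]| < m)%N.
  apply: leq_trans le_m; rewrite (cardsD1 i D) Di add1n ltnS.
  exact: subset_leq_card.
have [C [w [fl sC w_gt0 aE]]] := IHm a' lt_m.
have eN : [set j | a' j < 0] = [set j | a j < 0].
  by apply/setP => j; rewrite !inE neg_a'.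
rewrite eN in fl; have [C0 CN Cc] := flagP _ _ fl.
have subD U : U \in C -> U \subset D :\ i.
  by move=> /sC /subset_trans; apply.
have DC : D \notin C.
  by apply/negP => /subD /subsetP/(_ i Di); rewrite !inE eqxx.
exists (D |: C), (fun U => if U == D then a i else w U); split.
- apply/flagP; split=> [U|U j|U V]; rewrite in_setU1.
  + by move=> /orP[/eqP ->|/C0 //]; apply/set0Pn; exists i.
  + move=> /orP[/eqP ->|/CN]; last exact.
    by rewrite !inE -leNgt; apply: ltW.
  + move=> /orP[/eqP ->|CU]; rewrite in_setU1 => /orP[/eqP ->|CV].
    * by rewrite subxx.
    * by rewrite (subset_trans (subD _ CV) (subsetDl _ _)) orbT.
    * by rewrite (subset_trans (subD _ CU) (subsetDl _ _)).
    * exact: Cc.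
- move=> U; rewrite in_setU1 => /orP[/eqP -> //|/subD/subset_trans]; apply.
  exact: subsetDl.
- move=> U; rewrite in_setU1; case: eqP => //= _; exact: w_gt0.
- move=> x; rewrite big_setU1 //= eqxx.
  rewrite (eq_bigr (fun U => w U * \sum_(i in U) x i)) => [|U CU]; last first.
    by case: eqP CU => // ->; rewrite (negbTE DC).
  have -> : \sum_(j | a j < 0) a j * x j = \sum_(j | a' j < 0) a' j * x j.
    apply: eq_big => [j|j aj]; first by rewrite neg_a'.
    by rewrite /a' inE ltNge (ltW aj) subr0.
  rewrite -addrA -aE mulr_sumr [X in _ = X + _]big_mkcond -big_split /=.
  by apply: eq_bigr => j _; rewrite /a'; case: ifP => _; lra.
Qed.

End Functional.

(** * The nonempty faces are the flag faces *)

Section Classification.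
Variables (R : realType) (n : nat) (b : n.-tuple nat).
Hypothesis b_gt0 : forall i : 'I_n, (0 < tnth b i)%N.
Implicit Types (N U L : {set 'I_n}) (C : {set {set 'I_n}}) (x : 'rV[R]_n).

Local Notation P := (parking_polytope R b).
Local Notation flag_face := (@flag_face R n b).

Lemma exists_flag_face N C : flag N C -> exists x, flag_face N C x.
Proof.
move=> fl; have [s s_mono] := exists_perm_homo (level N C).
exists (vertex R b s N); apply: vertex_in_flag_face => //.
by move=> i; rewrite -(level_eq0 fl) => /eqP ->.
Qed.

(* The constraints are simultaneously tight somewhere on P, so a combination
   with positive weights attains its bound exactly where each of them is tight. *)
Lemma flag_face_max N C (w : {set 'I_n} -> R) (v : 'I_n -> R) (a : 'I_n -> R) (c : R) :
    flag N C -> (forall U, U \in C -> 0 < w U) -> (forall i, i \in N -> v i < 0) ->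
    (forall x : 'I_n -> R, \sum_i a i * x i =
        \sum_(U in C) w U * \sum_(i in U) x i + \sum_(i in N) v i * x i) ->
    c = \sum_(U in C) w U * (top_sum b #|U|)%:R + \sum_(i in N) v i ->
  (forall x, P x -> \sum_i a i * x 0 i <= c) /\
  (forall x, flag_face N C x <-> P x /\ \sum_i a i * x 0 i = c).
Proof.
move=> fl w_gt0 v_lt0 aE ->.
pose slackC x U := w U * ((top_sum b #|U|)%:R - \sum_(i in U) x 0 i).
pose slackN x i := v i * (1 - x 0 i).
have slackE x : \sum_(U in C) w U * (top_sum b #|U|)%:R + \sum_(i in N) v i
    - \sum_i a i * x 0 i = \sum_(U in C) slackC x U + \sum_(i in N) slackN x i.
  rewrite aE opprD addrACA -!sumrB.
  by congr (_ + _); apply: eq_bigr => j _; rewrite ?/slackC ?/slackN mulrBr ?mulr1.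
have slackC_ge0 x U : P x -> U \in C -> 0 <= slackC x U.
  by move=> Px CU; rewrite mulr_ge0 ?subr_ge0 ?parking_polytope_top // ltW ?w_gt0.
have slackN_ge0 x i : P x -> i \in N -> 0 <= slackN x i.
  move=> Px Ni; rewrite mulr_le0 ?subr_le0 ?(parking_polytope_ge1 _ Px) //.
  by rewrite ltW ?v_lt0.
split=> [x Px|x].
  by rewrite -subr_ge0 slackE addr_ge0 // sumr_ge0 // => j; [apply: slackC_ge0|apply: slackN_ge0].
split=> [[Px xN xC]|[Px /eqP]].
  split=> //; apply/eqP; rewrite eq_sym -subr_eq0 slackE; apply/eqP.
  rewrite !big1 ?addr0 // => [i Ni|U CU]; first by rewrite /slackN xN // subrr mulr0.
  by rewrite /slackC xC // subrr mulr0.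
rewrite eq_sym -subr_eq0 slackE paddr_eq0 ?sumr_ge0 // => [|U CU|i Ni]; last 2 first.
- exact: slackC_ge0.
- exact: slackN_ge0.
rewrite !psumr_eq0 => [/andP[/allP sC /allP sN]|i Ni|U CU]; last 2 first.
- exact: slackN_ge0.
- exact: slackC_ge0.
split=> // [i Ni|U CU].
  have := sN i (mem_index_enum _); rewrite Ni /= mulf_eq0 (lt_eqF (v_lt0 _ Ni)) /=.
  by rewrite subr_eq0 eq_sym => /eqP.
have := sC U (mem_index_enum _); rewrite CU /= mulf_eq0 (gt_eqF (w_gt0 _ CU)) /=.
by rewrite subr_eq0 eq_sym => /eqP.
Qed.

Lemma is_face_flag_face N C : flag N C -> is_face P (flag_face N C).
Proof.
(* Any positive weights on [C] and negative ones on [N] would expose the face. *)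
move=> fl; pose w (U : {set 'I_n}) : R := 1; pose v (i : 'I_n) : R := -1.
pose a i : R := \sum_(U in C) (i \in U)%:R - (i \in N)%:R.
pose c : R := \sum_(U in C) w U * (top_sum b #|U|)%:R + \sum_(i in N) v i.
have aE (x : 'I_n -> R) : \sum_i a i * x i =
    \sum_(U in C) w U * \sum_(i in U) x i + \sum_(i in N) v i * x i.
  under eq_bigr do rewrite mulrBl mulr_suml.
  rewrite sumrB exchange_big /=; congr (_ + _).
    by apply: eq_bigr => U _; rewrite mul1r sum_indicator.
  rewrite sum_indicator -sumrN; apply: eq_bigr => i _.
  by rewrite mulN1r mulrN.
have [le_c face] := @flag_face_max N C w v a c fl (fun _ _ => ltr01)
  (fun _ _ => ltrN10 R) aE erefl.
exists (\row_i a i), c; split=> [x Px|].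
  by under eq_bigr do rewrite mxE; apply: le_c.
apply: boolp.funext => x; apply: boolp.propext; rewrite face.
have -> : \sum_i a i * x 0 i = \sum_i (\row_i a i) 0 i * x 0 i.
  by apply: eq_bigr => i _; rewrite mxE.
by split=> -[].
Qed.

Lemma is_face_flag (F : classical_sets.set 'rV[R]_n) x0 : is_face P F -> F x0 ->
  exists N C, flag N C /\ F = flag_face N C.
Proof.
move=> [a [c [le_c ->]]] [Px0 /= x0c].
have [C [w [fl _ w_gt0 aE]]] := functional_flag (fun i => a 0 i).
pose N := [set i | a 0 i < 0]; exists N, C; split=> //.
have [] := @flag_face_max N C w (fun i => a 0 i) (fun i => a 0 i) _ fl w_gt0 _ _ erefl.
- by move=> i; rewrite inE.
- move=> x; rewrite aE; congr (_ + _); by apply: eq_bigl => i; rewrite inE.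
set d := (_ + _) => le_d face.
(* Both are the maximum of the functional on the polytope: [c] is attained at [x0], and [d] on the
   flag face, which is nonempty. *)
have e_cd : c = d.
  apply/eqP; rewrite eq_le; apply/andP; split; first by rewrite -x0c le_d.
  by have [x /face[Px <-]] := exists_flag_face fl; apply: le_c.
apply: boolp.funext => x; apply: boolp.propext; rewrite face -e_cd.
by split=> -[].
Qed.

Lemma top_sum_coatom : nth 0%N b 0 = 1%N -> (0 < n)%N ->
  top_sum b n = (top_sum b n.-1).+1.
Proof.
move=> b1 n0; pose p0 := Ordinal n0.
have -> : top_sum b n = (\sum_p bsum b p)%N.
  by apply: eq_bigl => p; rewrite inE subnn.
rewrite (bigD1 p0) //= bsum0 // b1 add1n; congr _.+1.
apply: eq_bigl => p; rewrite inE -val_eqE /=; lia.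
Qed.

(** The bounds for the whole set and for the complement of [i] differ by [b_1 = 1], so tightness of
    the latter forces [x_i = 1]. The whole set is then tight too; as it meets [[set i]], it is
    removed from [C]. *)
Lemma flag_face_merge C (i : 'I_n) : nth 0%N b 0 = 1%N -> flag set0 C ->
  [set~ i] \in C -> flag [set i] (C :\ setT) /\ flag_face set0 C = flag_face [set i] (C :\ setT).
Proof.
move=> b1 fl Ci; have [C0 CN Cc] := flagP _ _ fl.
have n0 : (0 < n)%N by apply: leq_ltn_trans (ltn_ord i).
have UT U : U \in C -> i \in U -> U = setT.
  move=> CU Ui; apply/eqP; rewrite eqEsubset subsetT /= -(setUCr [set i]) subUset sub1set Ui /=.
  by have /orP[/subsetP/(_ i Ui)|] := Cc _ _ CU Ci; rewrite // !inE eqxx.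
split.
  apply/flagP; split=> [U|U j|U V]; rewrite !inE.
  - by move=> /andP[_ /C0].
  - by move=> /andP[UT' CU] Uj; apply: contraNneq UT' => eji; rewrite (UT U) // -eji.
  - by move=> /andP[_ CU] /andP[_ CV]; apply: Cc.
have ci : #|[set~ i]| = n.-1 by rewrite cardsC1 card_ord.
have sumT x : \sum_(j in setT) x 0 j = x 0 i + \sum_(j in [set~ i]) x 0 j.
  rewrite (bigD1 i) ?inE //=; congr (_ + _).
  by apply: eq_bigl => j; rewrite !inE.
have topT : (top_sum b #|[set: 'I_n]|)%:R = 1 + (top_sum b #|[set~ i]|)%:R :> R.
  by rewrite cardsT card_ord ci top_sum_coatom // -nat1r.
apply: boolp.funext => x; apply: boolp.propext; split=> -[Px xN xC]; split=> //.
- move=> j /set1P ->; apply/eqP; rewrite eq_le (parking_polytope_ge1 _ Px) andbT.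
  have := parking_polytope_top b_gt0 setT Px; rewrite topT sumT (xC _ Ci).
  by rewrite lerD2r.
- by move=> U /setD1P[_ /xC].
- by move=> j; rewrite inE.
- move=> U CU; have [->|UnT] := eqVneq U setT; last by apply: xC; rewrite !inE UnT.
  rewrite topT sumT xN ?inE // xC // !inE Ci andbT.
  by apply/eqP => /setP/(_ i); rewrite !inE eqxx.
Qed.

Lemma flag_face_proper N C :
    (0 < n)%N -> ~ (n = 1%N /\ nth 0%N b 0 = 1%N) -> flag N C ->
  exists N' C', proper_flag b N' C' /\ flag_face N C = flag_face N' C'.
Proof.
move=> n0 not_pt fl.
have [b1|b1] := ltnP 1 (nth 0%N b 0); first by exists N, C; rewrite /proper_flag fl b1.
have b1' : nth 0%N b 0 = 1%N.
  by have := b_gt0 (Ordinal n0); rewrite (tnth_nth 0%N) /=; lia.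
have n1 : (1 < n)%N.
  by rewrite ltn_neqAle n0 andbT; apply/eqP => e1; apply: not_pt; split.
case: (boolP (reducible (N, C))) => [/andP[/eqP/= N0 /existsP[i Ci]]|nred]; last first.
  by exists N, C; rewrite /proper_flag fl n1 nred orbT.
subst N; have [fl' eF] := flag_face_merge b1' fl Ci.
exists [set i], (C :\ setT); split=> //; rewrite /proper_flag fl' n1 /reducible /=.
suff /negbTE-> : [set i] != set0 by rewrite orbT.
by apply/set0Pn; exists i; rewrite inE.
Qed.

End Classification.

(** * Dimension of the faces *)

Section AffineHull.
Variables (R : realType) (n : nat).

Lemma affine_hull_sub (A : classical_sets.set 'rV[R]_n) x : A x -> affine_hull A x.
Proof.
move=> Ax; exists 1%N, (fun=> x), (fun=> 1).
by rewrite !big_ord1 scale1r.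
Qed.

Lemma affine_hull_shift (A : classical_sets.set 'rV[R]_n) y x x' (c : R) :
  affine_hull A y -> A x -> A x' -> affine_hull A (y + c *: (x - x')).
Proof.
move=> [m [z [w [Az w1 ->]]]] Ax Ax'.
(* Prepend the points [x] and [x'] with weights [c] and [- c], which leaves the total weight equal
   to 1. *)
pose ext T (p q : T) (f : 'I_m -> T) (i : 'I_m.+2) : T :=
  if unlift ord0 i is Some j then
    if unlift ord0 j is Some k then f k else q
  else p.
exists m.+2, (ext _ x x' z), (ext _ c (- c) w); split=> [i||].
- by rewrite /ext; case: unlift => // j; case: unlift.
- by rewrite !big_ord_recl /ext !liftK !unlift_none; under eq_bigr do rewrite !liftK;
    rewrite w1; lra.
- rewrite !big_ord_recl /ext !liftK !unlift_none; under [in RHS]eq_bigr do rewrite !liftK.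
  by rewrite addrA scaleNr -scalerBr addrC.
Qed.

(** The direction space consists of the differences of points of the affine hull, so it does not
    depend on the base point. *)
Lemma has_dim_unique (A : classical_sets.set 'rV[R]_n) k l :
  has_dim A k -> has_dim A l -> k = l.
Proof.
have sub (x y : 'rV[R]_n) (V W : {vspace 'rV[R]_n}) :
    (forall z, (exists2 v, v \in V & x + v = z) -> exists2 v, v \in W & y + v = z) ->
  (V <= W)%VS.
  move=> h; apply/subvP => v Vv.
  have [w Ww ew] := h x (ex_intro2 _ _ 0 (mem0v V) (addr0 x)).
  have [w' Ww' ew'] := h (x + v) (ex_intro2 _ _ v Vv erefl).
  have -> : v = w' - w.
    by apply: (addrI x); rewrite -ew' -ew -addrA (addrCA w) subrr addr0.
  exact: memvB.
move=> [x [V [<- eV]]] [y [W [<- eW]]].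
have h z : (exists2 v, v \in V & x + v = z) <-> (exists2 v, v \in W & y + v = z).
  have := congr1 (fun B : classical_sets.set 'rV[R]_n => B z) (etrans (esym eV) eW).
  by rewrite /classical_sets.image /= => ->.
by congr (\dim _); apply/eqP; rewrite eqEsubv; apply/andP; split;
  [apply: (sub x y)|apply: (sub y x)] => z /h.
Qed.

Lemma has_dim_nonempty (A : classical_sets.set 'rV[R]_n) k :
  has_dim A k -> exists x, A x.
Proof.
move=> [x [V [_ eV]]].
have : affine_hull A x.
  by rewrite eV; exists 0; rewrite ?addr0 //; apply: mem0v.
move=> [[|m] [z [w [Az w1 _]]]]; last by exists (z ord0).
by move/eqP: w1; rewrite big_ord0 eq_sym oner_eq0.
Qed.

End AffineHull.

Section Dimension.
Variables (R : realType) (n : nat) (b : n.-tuple nat).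
Hypothesis b_gt0 : forall i : 'I_n, (0 < tnth b i)%N.
Variables (N : {set 'I_n}) (C : {set {set 'I_n}}).
Hypothesis pNC : proper_flag b N C.
Let fl : flag N C. Proof. by case/andP: pNC. Qed.
Local Notation lev := (level N C).
Local Notation face := (@flag_face R n b N C).

(** One chosen point per level. The default is never reached, since [i] itself qualifies. *)
Definition level_rep (i : 'I_n) : 'I_n := odflt i [pick k | lev k == lev i].
Local Notation rep := level_rep.

Lemma level_repE i : lev (rep i) = lev i.
Proof. by rewrite /rep; case: pickP => //= k /eqP. Qed.

Lemma eq_level_rep i j : lev i = lev j -> rep i = rep j.
Proof.
move=> e; rewrite /rep; under eq_pick do rewrite e.
by case: pickP => //= /(_ j); rewrite eqxx.
Qed.

(** On the affine hull of the face, coordinates of level 0 are fixed, those of level 1 are free, and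
    each higher level has a prescribed sum, which determines its representative from the others. *)
Definition free_coords : {set 'I_n} :=
  [set i | (0 < lev i)%N && ((lev i == 1%N) || (rep i != i))].
Local Notation J := free_coords.

(** Each point lies in exactly one of [J], [N] and the set [K] of representatives of levels above 1;
    upper sets put [K] in bijection with [C]. *)
Lemma card_free_coords : (#|J| + (#|N| + #|C|))%N = n.
Proof.
pose K := [set i | (1 < lev i)%N && (rep i == i)].
have -> : #|C| = #|K|.
  rewrite -(@card_in_imset _ _ (upper N C)) => [|i j]; last first.
    rewrite !inE => /andP[_ /eqP <-] /andP[_ /eqP <-] /setP e; apply: eq_level_rep.
    have := e (rep i); have := e (rep j); rewrite !inE !leqnn !level_repE => h1 h2.
    by apply/eqP; rewrite eqn_leq h1 -h2.
  apply: eq_card => U; apply/idP/imsetP => [/(flag_upper fl)[i i2 ->]|[i + ->]].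
    exists (rep i); last by rewrite /upper level_repE.
    by rewrite inE level_repE i2; apply/eqP/eq_level_rep; rewrite level_repE.
  by rewrite inE => /andP[i2 _]; apply: (upper_in fl).
rewrite -[RHS]card_ord -[RHS]cardsT -!sum1_card.
rewrite big_mkcond [X in (_ + (X + _))%N]big_mkcond [X in (_ + (_ + X))%N]big_mkcond.
rewrite [RHS]big_mkcond -!big_split /=; apply: eq_bigr => i _.
rewrite !inE -(level_eq0 fl); case: (lev i) => [|[|m]] //=.
by case: (rep i == i).
Qed.

Definition direction (i : 'I_n) : 'rV[R]_n :=
  delta_mx 0 i - (if (1 < lev i)%N then delta_mx 0 (rep i) else 0).

Lemma directionE i k :
  direction i 0 k = (k == i)%:R - ((1 < lev i)%N && (k == rep i))%:R.
Proof. by rewrite !mxE; case: ifP => _; rewrite !mxE. Qed.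

Lemma direction_free i k : i \in J -> k \in J -> direction i 0 k = (k == i)%:R.
Proof.
rewrite !inE directionE => _ /andP[_ Jk].
suff /negbTE -> : ~~ ((1 < lev i)%N && (k == rep i)) by rewrite subr0.
apply/negP => /andP[i2 /eqP ek]; move: Jk.
by rewrite ek level_repE gtn_eqF //= (@eq_level_rep (rep i) i) ?level_repE ?eqxx.
Qed.

(** Superlevel sets at 2 and above are empty or members of [C], so differences of their sums show
    that [v] sums to 0 over each level above 1. Its free coordinates thus determine it. *)
Lemma direction_expand (v : 'rV[R]_n) :
    (forall i, i \in N -> v 0 i = 0) ->
    (forall U, U \in C -> \sum_(i in U) v 0 i = 0) ->
  v = \sum_(i in J) v 0 i *: direction i.
Proof.
move=> vN vC.
have sum_ge t : (1 < t)%N -> \sum_(i | (t <= lev i)%N) v 0 i = 0.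
  move=> t2; pose W := [set i | (t <= lev i)%N].
  have -> : \sum_(i | (t <= lev i)%N) v 0 i = \sum_(i in W) v 0 i.
    by apply: eq_bigl => i; rewrite inE.
  have [->|/set0Pn[i0 Wi0]] := eqVneq W set0; first by rewrite big_set0.
  apply/vC/(flag_set_upper_closed fl Wi0) => [i|i k]; rewrite !inE.
    exact: leq_trans.
  by rewrite -ltnNge => le_ti lt_kt; apply: leq_trans le_ti.
have sum_eq k : (1 < lev k)%N -> \sum_(i | lev i == lev k) v 0 i = 0.
  move=> k2; have := sum_ge _ k2.
  rewrite (bigID (fun i => lev i == lev k)) /=.
  rewrite [X in _ + X](eq_bigl (fun i => (lev k < lev i)%N)) => [|i]; last by lia.
  rewrite sum_ge ?addr0; last exact: ltnW.
  by move=> e0; rewrite -[RHS]e0; apply: eq_bigl => i; lia.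
apply/rowP => k; rewrite summxE.
under eq_bigr do rewrite mxE.
have [Jk|Jk] := boolP (k \in J).
  rewrite (bigD1 k) //= direction_free // eqxx mulr1 big1 ?addr0 // => i /andP[Ji ik].
  by rewrite direction_free // eq_sym (negbTE ik) mulr0.
have [/eqP k0|k_gt0] := posnP (lev k).
  rewrite vN -?(level_eq0 fl) // big1 // => i Ji; rewrite directionE.
  have /negbTE-> : k != i by apply: contraNneq Jk => ->.
  case i2 : (1 < lev i)%N; rewrite /= ?subrr ?mulr0 //.
  suff /negbTE-> : k != rep i by rewrite subrr mulr0.
  by apply/eqP => ek; rewrite -(level_repE i) -ek (eqP k0) in i2.
move: Jk; rewrite !inE k_gt0 /= negb_or negbK => /andP[k1 /eqP rk].
have k2 : (1 < lev k)%N by rewrite ltn_neqAle eq_sym k1.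
(* For a representative [k], the vanishing sum over its level is compared term by term: among the
   free [i], [direction i] has entry -1 at [k] exactly for those of that level, and entry 0
   otherwise. *)
apply/eqP; rewrite -subr_eq0 -[X in _ == X](sum_eq k k2) [X in _ == X](bigD1 k) //=; apply/eqP.
congr (_ + _); rewrite -sumrN big_mkcond [RHS]big_mkcond /=; apply: eq_bigr => i _.
have [->|ik] := eqVneq i k; first by rewrite !inE k_gt0 (negbTE k1) rk eqxx eqxx.
rewrite inE directionE (eq_sym k i) (negbTE ik) andbT sub0r.
have [e|ne] := eqVneq (lev i) (lev k).
  rewrite e k_gt0 (negbTE k1) (eq_level_rep e) rk eq_sym ik k2 eqxx /=; lra.
case: ifP => // _; suff /negbTE-> : k != rep i by rewrite andbF oppr0 mulr0 oppr0.
by apply: contraNneq ne => ->; rewrite level_repE.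
Qed.

(** Above level 1, exchange the values at [i] and at its representative, which differ. At level 1,
    lower the coordinate [i] from a value at least 2 to 1. *)
Lemma direction_edge i : i \in J ->
  exists x x' (c : R), [/\ face x, face x', c != 0 & x - x' = c *: direction i].
Proof.
rewrite inE => /andP[i_gt0 Ji].
have levN k : k \in N -> (lev k <= 1)%N by rewrite -(level_eq0 fl) => /eqP ->.
have [i2|i1] := ltnP 1 (lev i).
  have ri : rep i != i by move: Ji; rewrite gtn_eqF.
  have [s s_mono] := exists_perm_homo lev.
  pose s' : {perm 'I_n} := (tperm i (rep i) * s)%g.
  have s'_mono j k : (lev j < lev k)%N -> (s' j < s' k)%N.
    have lev_t l : lev (tperm i (rep i) l) = lev l.
      by case: tpermP => [->|->|//]; rewrite level_repE.
    by move=> lt_jk; rewrite !permM; apply: s_mono; rewrite !lev_t.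
  have Ni k : lev k = lev i -> k \notin N.
    by move=> e; rewrite -(level_eq0 fl) e -lt0n.
  exists (vertex R b s N), (vertex R b s' N), ((bsum b (s i))%:R - (bsum b (s (rep i)))%:R).
  split; try by apply: vertex_in_flag_face.
    rewrite subr_eq0 eqr_nat (inj_eq (bsum_inj b_gt0)) (inj_eq perm_inj) eq_sym //.
  apply/rowP => k; rewrite [RHS]mxE directionE i2 !mxE permM.
  have [->|ki] := eqVneq k i.
    by rewrite tpermL (negbTE (Ni i erefl)) eq_sym (negbTE ri) subr0 mulr1.
  have [->|kr] := eqVneq k (rep i).
    rewrite tpermR (negbTE (Ni _ (level_repE i))) /=; lra.
  by rewrite tpermD 1?eq_sym // subrr subrr mulr0.
have lev1 : lev i = 1%N by apply/eqP; rewrite eqn_leq i1 i_gt0.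
have Ni : i \notin N by rewrite -(level_eq0 fl) lev1.
have [s [s_mono s_top]] := exists_perm_raise pNC i.
exists (vertex R b s N), (vertex R b s (i |: N)), ((bsum b (s i))%:R - 1); split.
- exact: vertex_in_flag_face.
- apply: vertex_in_flag_face => //; first exact: subsetUr.
  by move=> k; rewrite !inE => /orP[/eqP ->|/levN].
- by rewrite subr_eq0 pnatr_eq1 gtn_eqF // (bsum_raise_ge2 b_gt0 pNC).
- apply/rowP => k; rewrite [RHS]mxE directionE ltnNge i1 !mxE !inE /= subr0.
  have [->|ki] := eqVneq k i; first by rewrite (negbTE Ni) mulr1.
  by rewrite /= subrr mulr0.
Qed.

Lemma has_dim_flag_face : has_dim face (n - (#|N| + #|C|)).
Proof.
have [x0 Fx0] := @exists_flag_face R n b b_gt0 N C fl.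
pose X := [tuple direction (enum_val i) | i < #|J|].
have XE (i : 'I_#|J|) : X`_i = direction (enum_val i) by rewrite nth_mktuple.
have XJ i : i \in J -> direction i \in X.
  move=> Ji; apply/tnthP; exists (enum_rank_in Ji i).
  by rewrite tnth_mktuple enum_rankK_in.
have freeX : free X.
  apply/freeP => k sum0 j.
  have /rowP/(_ (enum_val j)) := sum0; rewrite summxE mxE (bigD1 j) //= big1 => [|i ij].
    by rewrite addr0 mxE XE direction_free ?enum_valP // eqxx mulr1.
  rewrite mxE XE direction_free ?enum_valP // (inj_eq enum_val_inj).
  by rewrite eq_sym (negbTE ij) mulr0.
exists x0, <<X>>%VS; split.
  by rewrite (eqP freeX) size_tuple; have := card_free_coords; lia.
have tangent x x' : face x -> face x' -> x - x' \in <<X>>%VS.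
  move=> [Px xN xC] [Px' xN' xC'].
  rewrite (@direction_expand (x - x')).
  - by apply: memv_suml => i Ji; apply/memvZ/memv_span/XJ.
  - by move=> i Ni; rewrite !mxE xN // xN' // subrr.
  - move=> U CU; under eq_bigr do rewrite !mxE.
    by rewrite sumrB xC // xC' // subrr.
apply: boolp.funext => y; apply: boolp.propext; split.
  move=> [m [z [w [Fz w1 ->]]]]; exists (\sum_i w i *: (z i - x0)).
    by apply: memv_suml => i _; apply/memvZ/tangent.
  by under eq_bigr do rewrite scalerBr; rewrite sumrB -scaler_suml w1 scale1r addrC subrK.
move=> [v /= Vv <-]; rewrite (@coord_span _ _ _ X v Vv).
have: affine_hull face x0 by apply: affine_hull_sub.
(* The base point is generalized to any point of the affine hull, so that the directions can be
   added one after the other. *)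
elim/big_ind: _ x0 {Fx0} => [x0|u1 u2 IH1 IH2 x0 /IH1/IH2|i _ x0 hx0].
- by rewrite addr0.
- by rewrite addrA.
have [x [x' [c [Fx Fx' c0 e]]]] := direction_edge (enum_valP i).
rewrite XE -[direction _](scalerK c0) -e scalerA.
exact: affine_hull_shift.
Qed.

End Dimension.

From mathcomp Require Import boolp classical_sets functions cardinality convex.

Local Open Scope card_scope.
Local Open Scope classical_set_scope.

(** * Counting the faces of a given dimension *)

Section Count.
Variables (R : realType) (n : nat) (b : n.-tuple nat).
Hypothesis b_gt0 : forall i : 'I_n, (0 < tnth b i)%N.
Hypothesis n_gt0 : (0 < n)%N.
Hypothesis not_point : ~ (n = 1%N /\ nth 0%N b 0 = 1%N).
Variables (k : nat) (k_le_n : (k <= n)%N).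

(** The map from proper flags to faces is a bijection in each dimension. The set [A] is given by its
    elements, to fit either case of the count. *)
Lemma card_faces_of_dim (A : {set {set 'I_n} * {set {set 'I_n}}}) :
    (forall c, (c \in A) = (c \in codes 'I_n (n - k)) && proper_flag b c.1 c.2) ->
  faces_of_dim (parking_polytope R b) k #= `I_#|A|.
Proof.
move=> AE; pose f (i : 'I_#|A|) := @flag_face R n b (enum_val i).1 (enum_val i).2.
have f_inj : injective f.
  move=> i j eF; apply: enum_val_inj; have := enum_valP i; have := enum_valP j.
  rewrite !AE => /andP[_ pj] /andP[_ pi]; have := flag_face_inj b_gt0 pi pj eF.
  by rewrite -!surjective_pairing.
have -> : faces_of_dim (parking_polytope R b) k = f @` [set: 'I_#|A|].
  apply/seteqP; split=> [F [faceF dimF]|_ [i _ <-]].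
    have [x Fx] := has_dim_nonempty dimF.
    have [N0 [C0 [fl0 eF0]]] := is_face_flag b_gt0 faceF Fx.
    have [N [C [pNC eF]]] := flag_face_proper R b_gt0 n_gt0 not_point fl0.
    rewrite eF in eF0; have dimF' := has_dim_flag_face R b_gt0 pNC.
    rewrite -eF0 in dimF'; have ek := has_dim_unique dimF dimF'.
    have A_NC : (N, C) \in A.
      rewrite AE inE /= pNC andbT; have /andP[-> _] := pNC.
      (* This keeps the truncated subtraction [n - (#|N| + #|C|)] exact, so that [k] determines
         [#|N| + #|C|]. *)
      have le_n : (#|N| + #|C| <= n)%N by rewrite -[X in (_ <= X)%N](card_free_coords pNC) leq_addl.
      by rewrite [in X in _ == X]ek subKn ?eqxx ?le_n.
    by exists (enum_rank_in A_NC (N, C)); rewrite // /f enum_rankK_in.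
  have := enum_valP i; rewrite AE inE => /andP[/andP[fl /eqP cNC] pNC]; split.
    exact: is_face_flag_face.
  have := has_dim_flag_face R b_gt0 pNC; rewrite cNC subKn //.
apply: card_eq_trans (inj_card_eq _) (card_esym card_II).
by move=> i j _ _; apply: f_inj.
Qed.

End Count.

Local Open Scope nat_scope.

Theorem corollary2p16 (R : realType) (n : nat) (b : n.-tuple nat)
    (n_gt0 : 0 < n) (b_gt0 : forall i : 'I_n, 0 < tnth b i)
    (not_point : ~ (n = 1 /\ nth 0 b 0 = 1))
    (k : nat) (k_le_n : k <= n) :
  (nth 0 b 0 = 1 ->
     faces_of_dim (parking_polytope R b) k #=
       `I_(\sum_(0 <= j < (n - k).+1 | j != 1)
             'C(n, j) * (n - k - j)`!
               * stirling2 (n - j + 1) (n - k - j + 1))) /\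
  (2 <= nth 0 b 0 ->
     faces_of_dim (parking_polytope R b) k #=
       `I_(\sum_(0 <= j < (n - k).+1)
             'C(n, j) * (n - k - j)`!
               * stirling2 (n - j + 1) (n - k - j + 1))).
Proof.
split=> b1.
  have n1 : 1 < n.
    by rewrite ltn_neqAle n_gt0 andbT; apply/eqP => e1; apply: not_point; split.
  have := card_codes 'I_n (n - k) (fun j => j != 1); rewrite card_ord => <-.
  (* Omitting [j = 1] counts the flags with [#|N| != 1], which are as many as the irreducible ones,
     that is, the proper flags when [b_1 = 1]. *)
  rewrite -card_irreducible ?card_ord //; apply: card_faces_of_dim => // c.
  rewrite !inE /proper_flag b1 n1 /= -surjective_pairing.
  by case: (flag _ _).
have := card_codes 'I_n (n - k) xpredT; rewrite card_ord => <-.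
apply: card_faces_of_dim => // c; rewrite !inE /proper_flag b1 /= !andbT.
by case: (flag _ _); rewrite ?andbT.
Qed.
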